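(* Let $G$ be a signed graph on $n$ nodes with Gremban expansion $\mathcal{G}$ and Gremban Laplacian $\mathcal{L}$. Let $\psi\in\mathbb{R}^{2n}$ be an eigenvector of $\mathcal{L}$ all of whose entries are nonzero, and define $\mathcal{U}_1=\{a\in V(\mathcal{G}):\psi(a)>0\}$ and $\mathcal{U}_2=\{a\in V(\mathcal{G}):\psi(a)<0\}$. (i) If $\psi$ is symmetric, then the cut-set $C(\mathcal{U}_1,\mathcal{U}_2)$ is Gremban-symmetric and $\pi(C(\mathcal{U}_1,\mathcal{U}_2))$ is a cut-set of $G$. (ii) If $\psi$ is antisymmetric, then $C(\mathcal{U}_1,\mathcal{U}_2)$ is Gremban-symmetric and $\pi(C(\mathcal{U}_1,\mathcal{U}_2))$ is a frustration set of $G$.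
   Context: A signed graph $G=(V,E,\sigma)$ has a finite node set $V=\{1,\dots,n\}$, undirected edges without loops or multi-edges, and signs $\sigma:E\to\{\pm1\}$. Its Gremban expansion $\mathcal{G}$ is the unsigned graph on nodes $v^+,v^-$ ($v\in V$) with edges $(u^\chi,v^{\chi\sigma(u,v)})$ for each $(u,v)\in E$, $\chi\in\{\pm\}$. The Gremban involution is $\eta(v^\chi)=v^{-\chi}$ (extended to edges and sets); a set $X$ is Gremban-symmetric if $\eta(X)=X$. The projection is $\pi(v^\chi)=v$, $\pi((u^\chi,v^\psi))=(u,v)$. Let $A^+$ (resp. $A^-$) be the $0/1$ adjacency matrix of the positive (resp. negative) edges of $G$ and $K$ the diagonal matrix of (unsigned) degrees. The Gremban Laplacian is the $2n\times 2n$ matrix $\mathcal{L}=\begin{pmatrix}K-A^+ & -A^-\\ -A^- & K-A^+\end{pmatrix}$, with coordinates indexed by $v^+$ (first block) and $v^-$ (second block); it is the Laplacian of $\mathcal{G}$. A vector $\psi\in\mathbb{R}^{2n}$ is symmetric if $\psi=(\mathbf{x},\mathbf{x})^\top$ and antisymmetric if $\psi=(\mathbf{x},-\mathbf{x})^\top$ for some $\mathbf{x}\in\mathbb{R}^n$. For a partition $S\cup T$ of the nodes, $C(S,T)$ is the set of edges with one end in $S$ and one in $T$; a cut-set of $G$ is any $C(S,T)$ with $V=S\cup T$. A frustration set of $G$ is any $F(\theta)=\{uv\in E:\theta(u)\theta(v)\sigma(uv)=-1\}$ for a switching function $\theta:V\to\{\pm1\}$. *)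

(* Defs.v *)
From mathcomp Require Import all_boot all_order all_algebra.
From mathcomp Require Import reals.

Set Implicit Arguments.
Unset Strict Implicit.
Unset Printing Implicit Defensive.

Import Order.TTheory GRing.Theory Num.Theory.
Local Open Scope ring_scope.

Record graph (T : finType) := Graph {
  edges : {set {set T}};
  card_edge : forall e, e \in edges -> #|e| = 2%N
}.

(* A sign is a boolean s read as (-1) ^+ s: false is +1, true is -1.  The
   product of signs is then addb and the opposite is negb. *)
Definition signT : Type := bool.

(* The values of [sign] outside the edge set are irrelevant. *)
Record signed_graph (n : nat) := SignedGraph {
  underlying :> graph 'I_n;
  sign : {set 'I_n} -> signT
}.

Section Cuts.
Variables (T : finType) (G : graph T).

Definition cut (S S' : {set T}) : {set {set T}} :=
  [set e in edges G | [exists s in S, exists t in S', e == [set s; t]]].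

(* One of the two parts may be empty, so the empty set is a cut-set. *)
Definition is_cutset (F : {set {set T}}) : Prop :=
  exists S S' : {set T},
    [/\ S :|: S' = [set: T], [disjoint S & S'] & F = cut S S'].

Definition degree (v : T) : nat := #|[set e in edges G | v \in e]|.

End Cuts.

Section Gremban.
Variables (n : nat) (G : signed_graph n).

Definition frustration (theta : 'I_n -> signT) : {set {set 'I_n}} :=
  [set e in edges G |
    [exists u, exists v,
      (e == [set u; v]) && (theta u (+) theta v (+) sign G e)]].

Definition is_frustration_set (F : {set {set 'I_n}}) : Prop :=
  exists theta : 'I_n -> signT, F = frustration theta.

(* v^+ is (v, false) and v^- is (v, true). *)
Definition gnode : finType := ('I_n * bool)%type.

Definition gremban_edges : {set {set gnode}} :=
  [set e | [exists u, exists v, exists chi : bool,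
     ([set u; v] \in edges G) &&
     (e == [set (u, chi); (v, chi (+) sign G [set u; v])])]].

Lemma card_gremban_edge e : e \in gremban_edges -> #|e| = 2%N.
Proof.
rewrite inE => /existsP[u /existsP[v /existsP[chi /andP[/card_edge]]]].
rewrite cards2 => uv /eqP ->.
by rewrite cards2 xpair_eqE; case: (u == v) uv.
Qed.

Definition gremban : graph gnode := Graph card_gremban_edge.

Definition signed_adj (R : nzRingType) (s : signT) : 'M[R]_n :=
  \matrix_(u, v)
    (([set u; v] \in edges G) && (sign G [set u; v] == s :> bool))%:R.

Definition degree_mx (R : nzRingType) : 'M[R]_n :=
  diag_mx (\row_v (degree G v)%:R).

Definition gremban_laplacian (R : nzRingType) : 'M[R]_(n + n) :=
  let Ap := signed_adj R false in
  let Am := signed_adj R true in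
  let K := degree_mx R in
  block_mx (K - Ap) (- Am)
           (- Am)   (K - Ap).

End Gremban.

Section Involution.
Variable n : nat.

Definition eta (a : gnode n) : gnode n := (a.1, ~~ a.2).

Definition gremban_symmetric (F : {set {set gnode n}}) : Prop :=
  [set eta @: (e : {set gnode n}) | e in F] = F.

Definition proj (a : gnode n) : 'I_n := a.1.

Definition proj_edges (F : {set {set gnode n}}) : {set {set 'I_n}} :=
  [set proj @: (e : {set gnode n}) | e in F].

(* v^+ is coordinate v of the first block, v^- coordinate v of the second. *)
Definition gindex (a : gnode n) : 'I_(n + n) :=
  if a.2 then rshift n a.1 else lshift n a.1.

End Involution.

Section Vectors.
Variables (R : realType) (n : nat).

Definition eigenvector m (A : 'M[R]_m) (psi : 'cV[R]_m) : Prop :=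
  psi != 0 /\ exists lambda : R, A *m psi = lambda *: psi.

Definition symmetric_vec (psi : 'cV[R]_(n + n)) : Prop :=
  exists x : 'cV[R]_n, psi = col_mx x x.

Definition antisymmetric_vec (psi : 'cV[R]_(n + n)) : Prop :=
  exists x : 'cV[R]_n, psi = col_mx x (- x).

Definition pos_nodes (psi : 'cV[R]_(n + n)) : {set gnode n} :=
  [set a | 0 < psi (gindex a) 0].

Definition neg_nodes (psi : 'cV[R]_(n + n)) : {set gnode n} :=
  [set a | psi (gindex a) 0 < 0].

End Vectors.

(* Main.v *)
(* If psi is symmetric (resp. antisymmetric), then the indicator s of its
   positive nodes satisfies s(v^chi) = theta v + k chi in Z/2, where theta is
   the restriction of s to V^+ and k = 0 (resp. k = 1).  The lift
   (u^chi, v^(chi sigma(uv))) of an edge uv is therefore cut if and only if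
   theta u + theta v + k sigma(uv) = 1, a condition which does not involve chi:
   the cut is invariant under eta, and it projects to the cut (k = 0) or the
   frustration set (k = 1) of theta. *)
Require Import Defs.
From mathcomp Require Import all_boot all_order all_algebra.
From mathcomp Require Import reals.
Import Order.TTheory GRing.Theory Num.Theory.
Local Open Scope ring_scope.

(** Edges are unordered, so the endpoint satisfying [s] can always be listed first; being cut
    becomes a parity condition. *)
Lemma cut_indicator (T : finType) (G : graph T) (s : pred T) :
  cut G [set a | s a] [set a | ~~ s a] =
  [set e in edges G | [exists a, exists b, (e == [set a; b]) && (s a (+) s b)]].
Proof.
apply/setP=> e; rewrite !inE; congr (_ && _); apply/idP/idP.
- move=> /existsP[a /andP[]]; rewrite inE => sa.
  move=> /existsP[b /andP[]]; rewrite inE => sb eab.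
  by apply/existsP; exists a; apply/existsP; exists b; rewrite eab sa (negbTE sb).
- move=> /existsP[a /existsP[b /andP[/eqP-> sab]]].
  case sa: (s a) sab => /= sb.
    apply/existsP; exists a; rewrite inE sa /=.
    by apply/existsP; exists b; rewrite inE sb /=.
  apply/existsP; exists b; rewrite inE sb /=.
  by apply/existsP; exists a; rewrite inE sa /= setUC.
Qed.

(** Makes the parity independent of how an edge is written as a pair. If [a] and [b] coincide, the
    parity is false and the premise fails. *)
Lemma addb_set2 (T : finType) (s : pred T) (a b c d : T) :
  [set a; b] = [set c; d] -> s a (+) s b -> s c (+) s d.
Proof.
move=> eq_ab.
have: a \in [set c; d] by rewrite -eq_ab set21.
have: b \in [set c; d] by rewrite -eq_ab set22.
by move=> /set2P[->|->] /set2P[->|->]; rewrite ?addbb // addbC.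
Qed.

Section GrembanCut.
Variables (n : nat) (G : signed_graph n).
Variables (s : pred (gnode n)) (theta : 'I_n -> bool) (k : bool).
Hypothesis sE : forall a, s a = theta a.1 (+) (k && a.2).

Let C := cut (gremban G) [set a | s a] [set a | ~~ s a].

Lemma gremban_cutP (e : {set gnode n}) :
  reflect (exists u v chi,
    [/\ [set u; v] \in edges G,
        theta u (+) theta v (+) (k && sign G [set u; v])
      & e = [set (u, chi); (v, chi (+) sign G [set u; v])]])
    (e \in C).
Proof.
(* [k && chi] occurs at both ends and cancels modulo 2. *)
have sab u v chi : s (u, chi) (+) s (v, chi (+) sign G [set u; v]) =
    theta u (+) theta v (+) (k && sign G [set u; v]).
  rewrite !sE /=.
  by case: k chi (theta u) (theta v) (sign G _) => [] [] [] [] [].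
rewrite /C cut_indicator inE; apply: (iffP andP).
- move=> [+ /existsP[a /existsP[b /andP[/eqP eab ab]]]].
  rewrite inE => /existsP[u /existsP[v /existsP[chi /andP[uv /eqP euv]]]].
  exists u, v, chi; split=> //; rewrite -(sab u v chi).
  by apply: addb_set2 ab; rewrite -eab.
- move=> [u [v [chi [uv thuv ->]]]]; split.
    rewrite inE; apply/existsP; exists u; apply/existsP; exists v.
    by apply/existsP; exists chi; rewrite uv eqxx.
  apply/existsP; exists (u, chi).
  by apply/existsP; exists (v, chi (+) sign G [set u; v]); rewrite eqxx sab.
Qed.

Lemma gremban_cut_symmetric : gremban_symmetric C.
Proof.
have etaC e : e \in C -> (@eta n) @: e \in C.
  move=> /gremban_cutP[u [v [chi [uv thuv ->]]]].
  apply/gremban_cutP; exists u, v, (~~ chi); split=> //.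
  by rewrite imsetU1 imset_set1 /eta /= addNb.
apply/setP=> e; apply/imsetP/idP => [[f fC ->]|eC]; first exact: etaC.
(* As [eta] is an involution, stability under [eta] already gives equality: [e] is the image of its
   own image. *)
exists ((@eta n) @: e); first exact: etaC.
rewrite -imset_comp -[LHS]imset_id; apply: eq_imset => -[u chi].
by rewrite /eta /= negbK.
Qed.

Lemma proj_gremban_cut :
  proj_edges C =
  [set e in edges G | [exists u, exists v,
     (e == [set u; v]) && (theta u (+) theta v (+) (k && sign G e))]].
Proof.
have projE u v chi chi' :
    (@proj n) @: [set (u, chi); (v, chi')] = [set u; v].
  by rewrite imsetU1 imset_set1.
apply/setP=> e; rewrite inE; apply/imsetP/andP.
- move=> [f /gremban_cutP[u [v [chi [uv thuv ->]]]] ->].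
  rewrite projE; split=> //; apply/existsP; exists u.
  by apply/existsP; exists v; rewrite eqxx.
- move=> [eE /existsP[u /existsP[v /andP[/eqP euv]]]]; subst e => thuv.
  (* The cut condition ignores [chi], so either lift of the edge would serve; [chi = false] is
     chosen. *)
  exists [set (u, false); (v, false (+) sign G [set u; v])]; last by rewrite projE.
  by apply/gremban_cutP; exists u, v, false.
Qed.

End GrembanCut.

Lemma is_cutset_indicator (T : finType) (G : graph T) (s : pred T) :
  is_cutset G
    [set e in edges G | [exists a, exists b, (e == [set a; b]) && (s a (+) s b)]].
Proof.
exists [set a | s a], [set a | ~~ s a]; rewrite cut_indicator; split=> //.
  by apply/setP=> a; rewrite !inE orbN.
by rewrite disjoints_subset; apply/subsetP=> a; rewrite !inE negbK.
Qed.

Theorem theorem4 (R : realType) (n : nat) (G : signed_graph n)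
    (psi : 'cV[R]_(n + n))
    (psi_eigen : eigenvector (gremban_laplacian G R) psi)
    (psi_neq0 : forall i : 'I_(n + n), psi i 0 != 0) :
  let C := cut (gremban G) (pos_nodes psi) (neg_nodes psi) in
  (symmetric_vec psi ->
     gremban_symmetric C /\ is_cutset G (proj_edges C)) /\
  (antisymmetric_vec psi ->
     gremban_symmetric C /\ is_frustration_set G (proj_edges C)).
Proof.
pose s (a : gnode n) := 0 < psi (gindex a) 0.
(* With no zero entries, not positive means negative. *)
have -> : neg_nodes psi = [set a | ~~ s a].
  by apply/setP=> a; rewrite !inE -leNgt le_eqVlt (negbTE (psi_neq0 _)).
rewrite -[pos_nodes psi]/[set a | s a] => C.
split=> -[x psiE]; pose theta v := 0 < x v 0.
- have sE a : s a = theta a.1 (+) (false && a.2).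
    case: a => v chi; rewrite /s /theta psiE /gindex addbF /=.
    by case: chi; rewrite (col_mxEd, col_mxEu).
  split; first exact: gremban_cut_symmetric sE.
  rewrite (proj_gremban_cut _ G _ _ _ sE).
  have := is_cutset_indicator _ G theta; congr (is_cutset _ _).
  apply/setP=> e; rewrite !inE; congr (_ && _).
  by apply: eq_existsb => u; apply: eq_existsb => v; rewrite addbF.
(* Negating an entry flips its strict positivity only if the entry is nonzero. *)
- have x_neq0 v : x v 0 != 0.
    by have := psi_neq0 (lshift n v); rewrite psiE col_mxEu.
  have sE a : s a = theta a.1 (+) (true && a.2).
    case: a => v chi; rewrite /s /theta psiE /gindex /=.
    case: chi; last by rewrite col_mxEu addbF.
    by rewrite col_mxEd mxE oppr_gt0 addbT -leNgt le_eqVlt (negbTE (x_neq0 v)).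
  split; first exact: gremban_cut_symmetric sE.
  (* Read as a switching function, [theta] is -1 where [x] is positive; a global sign change of
     [theta] leaves the frustration set unchanged. *)
  by exists theta; rewrite (proj_gremban_cut _ G _ _ _ sE).
Qed.
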